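(* Let $\{x^k\}$ be the sequence generated by the coordinate descent algorithm described in the context. Suppose that: (A) there exists $L>0$ such that, for every iteration $k$ and every trial point $z=z^{\mathrm{trial}}$ computed at iteration $k$, $$\|\nabla f_k(z)-\nabla M_k(z)\|\le L\|z-\bar x^k\|^p,\qquad M_k(\bar x^k)=f_k(\bar x^k),\qquad f_k(z)\le M_k(z)+L\|z-\bar x^k\|^{p+1};$$ (B) there exists $\bar m<+\infty$ such that, for all $i\in\{1,\dots,n\}$: there exists $k\le\bar m$ with $i\in I_k$; and for any $k\in\mathbb{N}$, if $i\in I_k$ then there exists $1\le m\le\bar m$ with $i\in I_{k+m}$. Then $$\lim_{k\to\infty}\|g_P(x^k)\|=0.$$ Moreover, if $x^*\in\Omega$ is a limit point of $\{x^k\}$, then $\|g_P(x^* )\|=0$.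
   Context: $\|\cdot\|$ is the Euclidean norm. Let $\Omega=\{x\in\mathbb{R}^n:\ell\le x\le u\}$ with $\ell,u\in\mathbb{R}^n$, $\ell<u$ componentwise, and let $f$ have continuous first derivatives over $\Omega$. $P_C$ denotes Euclidean projection onto a closed convex set $C$; $g(x)=\nabla f(x)$ and $g_P(x)=P_\Omega(x-g(x))-x$. For $v\in\mathbb{R}^n$ and $I\subseteq\{1,\dots,n\}$, $v_I\in\mathbb{R}^{|I|}$ is the subvector of components with indices in $I$. Coordinate descent algorithm. Given: $p\in\{1,2,3,\dots\}$, $\alpha>0$, $\sigma_{\min}>0$, $\tau_2\ge\tau_1>1$, $\theta>0$, $x^0\in\Omega$. At each iteration $k=0,1,2,\dots$: choose a nonempty $I_k\subseteq\{1,\dots,n\}$. For $z\in\mathbb{R}^{|I_k|}$ let $x^k[z]$ be the vector with $(x^k[z])_{I_k}=z$ and $(x^k[z])_i=x^k_i$ for $i\notin I_k$. Put $f_k(z)=f(x^k[z])$, $\Omega_k=\{z\in\mathbb{R}^{|I_k|}:\ell_{I_k}\le z\le u_{I_k}\}$, $\bar x^k=x^k_{I_k}$, and let $M_k:\mathbb{R}^{|I_k|}\to\mathbb{R}$ be a model of $f_k$ around $\bar x^k$ whose gradient exists on $\Omega_k$. Step 1: set $\sigma\leftarrow 0$. Step 2: compute a trial point $z^{\mathrm{trial}}\in\Omega_k$ with $M_k(z^{\mathrm{trial}})+\sigma\|z^{\mathrm{trial}}-\bar x^k\|^{p+1}\le M_k(\bar x^k)$ and $$\Big\|P_{\Omega_k}\big[z^{\mathrm{trial}}-\nabla\big(M_k(z)+\sigma\|z-\bar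 x^k\|^{p+1}\big)\big|_{z=z^{\mathrm{trial}}}\big]-z^{\mathrm{trial}}\Big\|\le\theta\|z^{\mathrm{trial}}-\bar x^k\|^p.$$ Step 3: if $f_k(z^{\mathrm{trial}})\le f_k(\bar x^k)-\alpha\|z^{\mathrm{trial}}-\bar x^k\|^{p+1}$, accept it: set $x^{k+1}=x^k[z^{\mathrm{trial}}]$, $\sigma_k=\sigma$, and go to iteration $k+1$. Otherwise set $\sigma\leftarrow\max\{\sigma_{\min},\tau\sigma\}$ with some $\tau\in[\tau_1,\tau_2]$ and return to Step 2. *)

(* Defs.v *)
From HB Require Import structures.
From mathcomp Require Import all_boot all_order all_algebra.
From mathcomp Require Import all_classical all_reals all_analysis.

Set Implicit Arguments.
Unset Strict Implicit.
Unset Printing Implicit Defensive.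

Import Order.TTheory GRing.Theory Num.Theory.
Import numFieldNormedType.Exports.

Local Open Scope classical_set_scope.
Local Open Scope ring_scope.

(* The library norm on row vectors is the max norm, hence a separate Euclidean
   norm; both induce the topology that the library puts on 'rV[R]_n. *)
Definition enorm (R : realType) (n : nat) (v : 'rV[R]_n) : R :=
  Num.sqrt (\sum_(i < n) v 0 i ^+ 2).

Definition box (R : realType) (n : nat) (l u : 'rV[R]_n) : set 'rV[R]_n :=
  [set x | forall i, l 0 i <= x 0 i <= u 0 i].

(* The minimizer is unique when C is nonempty, closed and convex; the value is
   the default 0 if there is no minimizer. *)
Definition eproj (R : realType) (n : nat) (C : set 'rV[R]_n) (y : 'rV[R]_n)
    : 'rV[R]_n :=
  xget 0 [set z | C z /\ forall w, C w -> enorm (z - y) <= enorm (w - y)].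

Definition has_grad (R : realType) (n : nat) (f : 'rV[R]_n -> R)
    (x : 'rV[R]_n) : Prop :=
  forall i : 'I_n, derivable f x (delta_mx 0 i).

(* Partial derivatives in 'D_v are two-sided, also at boundary points of a
   box: f is a total function and only its values near x matter. *)
Definition grad (R : realType) (n : nat) (f : 'rV[R]_n -> R) (x : 'rV[R]_n)
    : 'rV[R]_n :=
  \row_(i < n) 'D_(delta_mx 0 i) f x.

Definition C1_on (R : realType) (n : nat) (A : set 'rV[R]_n)
    (f : 'rV[R]_n -> R) : Prop :=
  (forall x, A x -> has_grad f x) /\ {within A, continuous (grad f)}.

Definition gproj (R : realType) (n : nat) (l u : 'rV[R]_n)
    (f : 'rV[R]_n -> R) (x : 'rV[R]_n) : 'rV[R]_n :=
  eproj (box l u) (x - grad f x) - x.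

(* Components of a subvector are listed by enum_val, i.e. in increasing order
   of the indices in I. *)
Definition subvec (R : realType) (n : nat) (I : {set 'I_n}) (v : 'rV[R]_n)
    : 'rV[R]_#|I| :=
  \row_(j < #|I|) v 0 (enum_val j).

(* x[z]: the components of x with index in I are replaced by those of z. *)
Definition plug (R : realType) (n : nat) (I : {set 'I_n}) (x : 'rV[R]_n)
    (z : 'rV[R]_#|I|) : 'rV[R]_n :=
  \row_(i < n) if [pick j : 'I_#|I| | enum_val j == i] is Some j
               then z 0 j else x 0 i.

Definition reg_model (R : realType) (m p : nat) (M : 'rV[R]_m -> R)
    (xbar : 'rV[R]_m) (sigma : R) (z : 'rV[R]_m) : R :=
  M z + sigma * enorm (z - xbar) ^+ p.+1.

Definition trial_point (R : realType) (m p : nat) (theta : R)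
    (lb ub : 'rV[R]_m) (M : 'rV[R]_m -> R) (xbar : 'rV[R]_m) (sigma : R)
    (z : 'rV[R]_m) : Prop :=
  [/\ box lb ub z,
      reg_model p M xbar sigma z <= M xbar
    & enorm (eproj (box lb ub) (z - grad (reg_model p M xbar sigma) z) - z)
        <= theta * enorm (z - xbar) ^+ p].

Definition suff_decrease (R : realType) (m p : nat) (alpha : R)
    (F : 'rV[R]_m -> R) (xbar z : 'rV[R]_m) : Prop :=
  F z <= F xbar - alpha * enorm (z - xbar) ^+ p.+1.

(* x^k, I_k and M_k, together with the inner loop of iteration k: the trial
   points computed there are ztrial k j for j <= J k, with regularization
   parameters sigma k j.  The trial points j < J k are rejected and j = J k is
   accepted.  Entries with j > J k are meaningless. *)
Record cd_data (R : realType) (n : nat) := CDData {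
  cd_x : nat -> 'rV[R]_n;
  cd_I : nat -> {set 'I_n};
  cd_M : forall k : nat, 'rV[R]_#|cd_I k| -> R;
  cd_J : nat -> nat;
  cd_sigma : nat -> nat -> R;
  cd_ztrial : forall k : nat, nat -> 'rV[R]_#|cd_I k|
}.

Arguments cd_M {R n} s k z : rename.

Definition cd_f (R : realType) (n : nat) (f : 'rV[R]_n -> R)
    (s : cd_data R n) (k : nat) (z : 'rV[R]_#|cd_I s k|) : R :=
  f (plug (cd_x s k) z).

Arguments cd_f {R n} f s k z.

Definition cd_xbar (R : realType) (n : nat) (s : cd_data R n) (k : nat)
    : 'rV[R]_#|cd_I s k| :=
  subvec (cd_I s k) (cd_x s k).

Record cd_run (R : realType) (n : nat) (l u : 'rV[R]_n) (f : 'rV[R]_n -> R)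
    (p : nat) (alpha sigmamin tau1 tau2 theta : R) (s : cd_data R n)
    : Prop := CDRun {
  cd_start : box l u (cd_x s 0);
  cd_nonempty : forall k, (0 < #|cd_I s k|)%N;
  cd_model : forall k z,
    box (subvec (cd_I s k) l) (subvec (cd_I s k) u) z ->
    has_grad (cd_M s k) z;
  cd_sigma0 : forall k, cd_sigma s k 0 = 0;
  cd_trial : forall k j, (j <= cd_J s k)%N ->
    trial_point p theta (subvec (cd_I s k) l) (subvec (cd_I s k) u)
      (cd_M s k) (cd_xbar s k) (cd_sigma s k j) (cd_ztrial s k j);
  cd_reject : forall k j, (j < cd_J s k)%N ->
    ~ suff_decrease p alpha (cd_f f s k) (cd_xbar s k)
        (cd_ztrial s k j) /\
    exists2 tau : R, tau1 <= tau <= tau2 &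
      cd_sigma s k j.+1 = Num.max sigmamin (tau * cd_sigma s k j);
  cd_accept : forall k,
    suff_decrease p alpha (cd_f f s k) (cd_xbar s k)
      (cd_ztrial s k (cd_J s k)) /\
    cd_x s k.+1 = plug (cd_x s k) (cd_ztrial s k (cd_J s k))
}.

Definition model_accuracy (R : realType) (n : nat) (f : 'rV[R]_n -> R)
    (p : nat) (s : cd_data R n) : Prop :=
  exists2 L : R, 0 < L & forall k j, (j <= cd_J s k)%N ->
    let z := cd_ztrial s k j in
    let xbar := cd_xbar s k in
    [/\ enorm (grad (cd_f f s k) z - grad (cd_M s k) z)
          <= L * enorm (z - xbar) ^+ p,
        cd_M s k xbar = cd_f f s k xbar
      & cd_f f s k z <= cd_M s k z + L * enorm (z - xbar) ^+ p.+1].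

Definition essentially_cyclic (R : realType) (n : nat) (s : cd_data R n)
    : Prop :=
  exists mbar : nat, forall i : 'I_n,
    (exists2 k, (k <= mbar)%N & i \in cd_I s k) /\
    (forall k, i \in cd_I s k ->
       exists2 m, (1 <= m <= mbar)%N & i \in cd_I s (k + m)).

Definition seq_limit_point (R : realType) (n : nat) (x : nat -> 'rV[R]_n)
    (y : 'rV[R]_n) : Prop :=
  exists2 phi : nat -> nat,
    {homo phi : i j / (i < j)%N} & x (phi k) @[k --> \oo] --> y.

(* Main.v *)
Require Import Defs.
From HB Require Import structures.
From mathcomp Require Import all_boot all_order all_algebra.
From mathcomp Require Import all_classical all_reals all_analysis.
From mathcomp Require Import ring lra zify.

Set Implicit Arguments.
Unset Strict Implicit.
Unset Printing Implicit Defensive.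

Import Order.TTheory GRing.Theory Num.Theory.
Import numFieldNormedType.Exports.

Local Open Scope classical_set_scope.
Local Open Scope ring_scope.

(* Any rejected regularization parameter is below L + alpha, so the parameters
   stay bounded. Since f is bounded below on the box, sufficient decrease forces
   the step lengths d_k to 0. The projection onto a box acts componentwise and is
   nonexpansive, so approximate stationarity of the accepted trial point for the
   regularized model becomes |g_P(x^(k+1))_i| <= C d_k^p for i in I_k. Each index
   i lies in one of any mbar + 1 consecutive blocks I_k, over which the iterates
   drift by at most mbar * max d_k; uniform continuity of g_P on the box then
   carries the bound to every k. *)

(** * The Euclidean norm against coordinates *)

Lemma enorm_ge0 (R : realType) (n : nat) (v : 'rV[R]_n) : 0 <= enorm v.
Proof. exact: sqrtr_ge0. Qed.

Lemma coord_le_enorm (R : realType) (n : nat) (v : 'rV[R]_n) (i : 'I_n) :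
  `|v 0 i| <= enorm v.
Proof.
rewrite -sqrtr_sqr ler_wsqrtr // (bigD1 i) //= lerDl.
by apply: sumr_ge0 => j _; rewrite sqr_ge0.
Qed.

Lemma enorm_le_sum (R : realType) (n : nat) (v : 'rV[R]_n) :
  enorm v <= \sum_(i < n) `|v 0 i|.
Proof.
have sum0 : 0 <= \sum_(i < n) `|v 0 i| by apply: sumr_ge0.
rewrite -[leRHS]ger0_norm // -sqrtr_sqr ler_wsqrtr //.
rewrite expr2 mulr_suml; apply: ler_sum => i _.
rewrite -real_normK ?num_real // expr2 ler_wpM2l // (bigD1 i) //= lerDl.
exact: sumr_ge0.
Qed.

(** * Projection onto an interval and onto a box *)

(** For [a <= b], the projection of [y] onto the interval [[a, b]]. *)
Definition clamp (R : realType) (a b y : R) : R := Num.max a (Num.min b y).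

Lemma clamp_itv (R : realType) (a b y : R) :
  a <= b -> a <= clamp a b y <= b.
Proof. by move=> ab; rewrite /clamp le_max lexx ge_max ab ge_min lexx. Qed.

(** With [c = clamp a b y], the cross term [2 (c - y) (w - c)] in the expansion of the right-hand
    side is nonnegative: the angle at the projection is obtuse. *)
Lemma clamp_obtuse (R : realType) (a b y w : R) : a <= w <= b ->
  (clamp a b y - y) ^+ 2 + (w - clamp a b y) ^+ 2 <= (w - y) ^+ 2.
Proof.
move=> /andP[aw wb]; rewrite /clamp.
case: (leP b y) => yb; case: (leP a _) => ay; nra.
Qed.

(** For [y <= y'], taking [min] or [max] with a constant keeps the order and never widens the
    gap. *)
Lemma clamp_lip (R : realType) (a b y y' : R) :
  `|clamp a b y - clamp a b y'| <= `|y - y'|.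
Proof.
wlog le_yy' : y y' / y <= y'.
  by move=> H; case: (leP y y') => [/H //|/ltW/H]; rewrite distrC (distrC y).
have -> : `|y - y'| = y' - y by rewrite distrC ger0_norm // subr_ge0.
have h1 : Num.min b y <= Num.min b y'.
  by rewrite le_min ge_min lexx ge_min le_yy' orbT.
have h2 : Num.min b y' <= Num.min b y + (y' - y).
  by rewrite /Num.min; case: ltP => ?; case: ltP => ?; lra.
have h3 : clamp a b y <= clamp a b y'.
  by rewrite /clamp ge_max le_max lexx le_max h1 orbT.
have h4 : clamp a b y' <= clamp a b y + (y' - y).
  rewrite /clamp ge_max; apply/andP; split.
    by rewrite -[leLHS]addr0 lerD ?le_max ?lexx // subr_ge0.
  by apply: (le_trans h2); rewrite lerD2r le_max lexx orbT.
by rewrite distrC ger0_norm; lra.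
Qed.

(** Summing [clamp_obtuse] over the coordinates gives [|c - y|^2 + |w - c|^2 <= |w - y|^2] for every
    [w] in the box. Hence [c] is a minimizer, and any other minimizer [w] has [|w - c|^2 <= 0]; this
    uniqueness determines the value of [xget]. *)
Lemma eproj_box (R : realType) (n : nat) (l u y : 'rV[R]_n) :
  (forall i, l 0 i <= u 0 i) ->
  eproj (box l u) y = \row_i clamp (l 0 i) (u 0 i) (y 0 i).
Proof.
move=> lu; set c := \row_i _.
have sum_ge0 (v : 'rV[R]_n) : 0 <= \sum_(i < n) v 0 i ^+ 2.
  by apply: sumr_ge0 => i _; rewrite sqr_ge0.
have obt (w : 'rV[R]_n) : box l u w ->
    \sum_(i < n) (c - y) 0 i ^+ 2 + \sum_(i < n) (w - c) 0 i ^+ 2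
      <= \sum_(i < n) (w - y) 0 i ^+ 2.
  move=> bw; rewrite -big_split; apply: ler_sum => i _.
  by rewrite !mxE; apply: clamp_obtuse (bw i).
have bc : box l u c by move=> i; rewrite mxE; exact: clamp_itv.
apply: xget_unique.
  split=> // w /obt bw; rewrite ler_wsqrtr //.
  by apply: le_trans bw; rewrite lerDl.
move=> w [bw /(_ _ bc)]; rewrite ler_sqrt // => wc.
have /le_trans/(_ wc) := obt _ bw; rewrite gerDl => wc0.
have wc0E : \sum_(i < n) (w - c) 0 i ^+ 2 = 0.
  by apply/eqP; rewrite eq_le wc0 sum_ge0.
have wc_eq0 := psumr_eq0P (fun i _ => sqr_ge0 ((w - c) 0 i)) wc0E.
apply/rowP => i; have /eqP := wc_eq0 i isT.
by rewrite sqrf_eq0 !mxE subr_eq0 => /eqP.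
Qed.

Lemma gprojE (R : realType) (n : nat) (l u : 'rV[R]_n) (f : 'rV[R]_n -> R)
    (x : 'rV[R]_n) (i : 'I_n) : (forall i, l 0 i <= u 0 i) ->
  gproj l u f x 0 i =
    clamp (l 0 i) (u 0 i) (x 0 i - grad f x 0 i) - x 0 i.
Proof. by move=> lu; rewrite /gproj eproj_box // !mxE. Qed.

(** * Compactness of the box and uniform continuity of the projected gradient *)

Lemma box_compact (R : realType) (n : nat) (l u : 'rV[R]_n) :
  compact (box l u).
Proof.
exact: (@rV_compact _ n (fun i => [set` `[l 0 i, u 0 i]])
  (fun i => @segment_compact R _ _)).
Qed.

(** Heine-Cantor. The covering form of compactness turns radii valid near each point into one radius
    valid on all of [K]. *)
Lemma compact_unif_continuous (R : realType) (T U : pseudoMetricType R)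
    (K : set T) (f : T -> U) : compact K -> {within K, continuous f} ->
  forall e : R, 0 < e -> exists2 d : R, 0 < d &
    forall x y, K x -> K y -> ball x d y -> ball (f x) e (f y).
Proof.
move=> /compact_near_coveringP cK /subspace_continuousP cf e e0.
pose P (d : R) (x : T) :=
  K x -> forall y, K y -> ball x d y -> ball (f x) e (f y).
have H : \forall d \near (0 : R)^'+, K `<=` P d.
  apply: cK => x Kx; have e20 : 0 < e / 2 by rewrite divr_gt0.
  have /nbhs_ballP[d /= d0 fd] := cf x Kx _ (nbhsx_ballx (f x) (e / 2) e20).
  have d20 : 0 < d / 2 by rewrite divr_gt0.
  (* Both [y] and any [z] within [t] of it then lie in the ball of radius [d] around [x], so [f y]
     and [f z] are each within [e / 2] of [f x]. *)
  exists (ball x (d / 2), [set t : R | t < d / 2]) => /=.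
    by split; [exact: nbhsx_ballx | exact: nbhs_right_lt].
  move=> [y t] /= [xy td] Ky z Kz yz.
  apply: (@ball_splitr _ _ (f x)).
    by apply: fd Ky; apply: le_ball xy; lra.
  apply: fd Kz; apply: (@ball_split _ _ y) => //.
  by apply: le_ball yz; exact: ltW.
have [d d0 KP] : exists2 d : R, 0 < d & K `<=` P d.
  near (0 : R)^'+ => d; exists d; first by near: d; exact: nbhs_right_gt.
  by near: d.
by exists d => // x y Kx; exact: KP.
Unshelve. all: by end_near.
Qed.

(** As [clamp] is nonexpansive, component [i] of [gproj] varies by at most [2 |x_i - y_i|] plus the
    variation of the partial derivative. Bounding all three contributions by [e / 3] suffices. *)
Lemma gproj_unif_continuous (R : realType) (n : nat) (l u : 'rV[R]_n)
    (f : 'rV[R]_n -> R) : (forall i, l 0 i <= u 0 i) ->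
  {within box l u, continuous (grad f)} ->
  forall e : R, 0 < e -> exists2 d : R, 0 < d &
    forall x y, box l u x -> box l u y ->
      (forall j, `|x 0 j - y 0 j| < d) ->
      forall i, `|gproj l u f x 0 i - gproj l u f y 0 i| < e.
Proof.
move=> lu cg e e0; have e30 : 0 < e / 3 by lra.
have [d d0 gd] := compact_unif_continuous (@box_compact _ _ l u) cg e30.
exists (Num.min d (e / 3)); first by rewrite lt_min d0.
move=> x y bx byy xy i; rewrite !gprojE //.
have gxy : `|grad f x 0 i - grad f y 0 i| < e / 3.
  have xyd : ball x d y.
    by split=> // a j; rewrite ord1; apply: lt_le_trans (xy j) _; rewrite ge_min lexx.
  by have [_ /(_ 0 i)] := gd _ _ bx byy xyd.
have xyi : `|x 0 i - y 0 i| < e / 3.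
  by apply: lt_le_trans (xy i) _; rewrite ge_min lexx orbT.
have := clamp_lip (l 0 i) (u 0 i) (x 0 i - grad f x 0 i) (y 0 i - grad f y 0 i).
move: gxy xyi; set a := clamp _ _ _; set b := clamp _ _ _.
have -> : x 0 i - grad f x 0 i - (y 0 i - grad f y 0 i)
  = (x 0 i - y 0 i) - (grad f x 0 i - grad f y 0 i) by ring.
have -> : a - x 0 i - (b - y 0 i) = (a - b) - (x 0 i - y 0 i) by ring.
move=> h1 h2 h3; have h4 := ler_normB (x 0 i - y 0 i) (grad f x 0 i - grad f y 0 i).
have h5 := ler_normB (a - b) (x 0 i - y 0 i).
lra.
Qed.

(** * Derivatives along lines and a lower bound for [f] on the box *)

(** Restriction to a line makes a directional derivative a one-variable one, to which the mean value
    theorem and the chain rule apply. *)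
Lemma diff_quotient_line (R : numFieldType) (V W : normedModType R) (f : V -> W)
    (x v : V) (t : R) :
  (fun h : R => h^-1 *: (((fun t : R => f (t *: v + x)) \o shift t) (h *: 1)
                         - f (t *: v + x)))
  = (fun h : R => h^-1 *: ((f \o shift (t *: v + x)) (h *: v)
                         - f (t *: v + x))).
Proof.
by apply/funext => h /=; rewrite [_%:A]mulr1 scalerDl addrA.
Qed.

Lemma derivable_line (R : numFieldType) (V W : normedModType R) (f : V -> W)
    (x v : V) (t : R) :
  derivable (fun t : R => f (t *: v + x)) t 1 <-> derivable f (t *: v + x) v.
Proof. by rewrite /derivable diff_quotient_line. Qed.

Lemma derive_line (R : numFieldType) (V W : normedModType R) (f : V -> W)
    (x v : V) (t : R) :
  'D_1 (fun t : R => f (t *: v + x)) t = 'D_v f (t *: v + x).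
Proof. by rewrite /derive diff_quotient_line. Qed.

Lemma is_derive_line (R : numFieldType) (V W : normedModType R) (f : V -> W)
    (x v : V) (t : R) : derivable f (t *: v + x) v ->
  is_derive t 1 (fun t : R => f (t *: v + x)) ('D_v f (t *: v + x)).
Proof. by move=> df; split; [exact/derivable_line | exact: derive_line]. Qed.

Lemma grad_bounded (R : realType) (n : nat) (l u : 'rV[R]_n)
    (f : 'rV[R]_n -> R) : {within box l u, continuous (grad f)} ->
  exists2 B : R, 0 < B & forall x i, box l u x -> `|grad f x 0 i| <= B.
Proof.
move=> cg.
have /compact_bounded/pinfty_ex_gt0[B B0 gB] :=
  continuous_compact cg (@box_compact _ _ l u).
exists B => // x i bx; have /= := gB (grad f x) (ex_intro2 _ _ x bx erefl).
apply: le_trans; rewrite /Num.norm /= mx_normrE.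
exact: (le_bigmax _ (fun ij => `|grad f x ij.1 ij.2|) (0, i)).
Qed.

(** [C1_on] speaks of partial derivatives, so the bound comes from these. The coordinates of [x] are
    lowered to those of [l] one at a time, along segments inside the box; on each, the mean value
    theorem limits the change of [f] to [B * (u_i - l_i)]. *)
Lemma C1_on_box_lbound (R : realType) (n : nat) (l u : 'rV[R]_n)
    (f : 'rV[R]_n -> R) : C1_on (box l u) f ->
  exists c, forall x, box l u x -> c <= f x.
Proof.
move=> [df cg]; have [B B0 gB] := grad_bounded cg.
(* The list [s] covers the coordinates in which [x] may still differ from [l]. *)
suff H (s : seq 'I_n) x : box l u x -> (forall i, i \notin s -> x 0 i = l 0 i) ->
    f l - B * (\sum_(i <- s) (u 0 i - l 0 i)) <= f x.
  exists (f l - B * (\sum_(i <- enum 'I_n) (u 0 i - l 0 i))) => x bx.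
  by apply: H => // i; rewrite mem_enum.
elim: s x => [|i s IH] x bx xl.
  rewrite big_nil mulr0 subr0 (_ : x = l) //.
  by apply/rowP => i; exact: xl.
pose e : 'rV[R]_n := delta_mx 0 i.
have eE (t : R) j : (t *: e + x) 0 j = (if j == i then t else 0) + x 0 j.
  by rewrite !mxE eqxx; case: (j == i); rewrite ?mulr1 ?mulr0.
have /andP[lxi xui] := bx i.
have bxt (t : R) : l 0 i - x 0 i <= t <= 0 -> box l u (t *: e + x).
  move=> /andP[t1 t2] j; rewrite eE; have := bx j.
  by case: (eqVneq j i) => [->|_]; rewrite ?add0r // => _; lra.
have ab : l 0 i - x 0 i <= 0 by lra.
(* The parameter [0] gives [x], and [l_i - x_i] gives [x] with coordinate [i] lowered to [l_i]. *)
have [t||t] := @MVT_segment R (fun t => f (t *: e + x))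
    (fun t => 'D_e f (t *: e + x)) _ _ ab.
- rewrite in_itv /= => /andP[t1 t2]; apply: is_derive_line.
  by apply: df; apply: bxt; rewrite !ltW.
- apply: derivable_within_continuous => t; rewrite in_itv /= => tab.
  by apply/derivable_line; apply: df; exact: bxt.
rewrite in_itv /= scale0r add0r => tab ft.
have /gB -/(_ i) : box l u (t *: e + x) by exact: bxt.
rewrite mxE => /ler_normlP[g1 g2].
have bxl : box l u ((l 0 i - x 0 i) *: e + x) by apply: bxt; rewrite lexx.
have fl : f l - B * (\sum_(j <- s) (u 0 j - l 0 j))
    <= f ((l 0 i - x 0 i) *: e + x).
  apply: IH => // j js; rewrite eE; case: (eqVneq j i) => [->|ji].
    by rewrite subrK.
  by rewrite add0r xl // inE negb_or ji.
rewrite big_cons mulrDr.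
move: fl ft g1 g2; set a := 'D_e f _; set b := f _.
move=> fl ft g1 g2.
have : a * (0 - (l 0 i - x 0 i)) >= - (B * (u 0 i - l 0 i)) by nra.
lra.
Qed.

(** * Partial derivatives of powers of the Euclidean norm *)

(** This is a power of the norm along a coordinate line: [b] is the moving coordinate and [a] the
    sum of squares of the others. An exponent of at least 2 gives differentiability even at the
    origin, where the square root has none. *)
Lemma is_derive_sqrt_sqr_pow (R : realType) (a b : R) (q : nat) : 0 <= a ->
  exists2 d : R,
    is_derive (0 : R) 1 (fun h : R => Num.sqrt (a + (b + h) ^+ 2) ^+ q.+2) d &
    `|d| <= q.+2%:R * Num.sqrt (a + b ^+ 2) ^+ q.+1.
Proof.
move=> a0; have b2 := sqr_ge0 b.
have : 0 <= a + b ^+ 2 by rewrite addr_ge0.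
rewrite le_eqVlt => /orP[/eqP ab0|ab0].
  have [-> ->] : a = 0 /\ b = 0.
    have b20 : b ^+ 2 = 0 by lra.
    by split; [lra | apply/eqP; rewrite -sqrf_eq0 b20].
  exists 0; last by rewrite normr0 mulr_ge0 // exprn_ge0 ?sqrtr_ge0.
  have cvg0 : h^-1 *: (((fun h : R => Num.sqrt (0 + (0 + h) ^+ 2) ^+ q.+2)
      \o shift (0 : R)) (h *: 1) - Num.sqrt (0 + (0 + 0) ^+ 2) ^+ q.+2)
      @[h --> (0 : R)^'] --> (0 : R).
    (* At the origin the difference quotient is [h * |h|^q], which tends to 0. *)
    have -> : (fun h : R => h^-1 *:
        (((fun h : R => Num.sqrt (0 + (0 + h) ^+ 2) ^+ q.+2)
        \o shift (0 : R)) (h *: 1) - Num.sqrt (0 + (0 + 0) ^+ 2) ^+ q.+2))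
      = (fun h : R => h * `|h| ^+ q).
      apply/funext => h /=; rewrite !add0r addr0 [_%:A]mulr1 expr0n sqrtr0.
      rewrite expr0n subr0 sqrtr_sqr !exprS mulrA -expr2 real_normK ?num_real //.
      have [->|h0] := eqVneq h 0; first by rewrite expr0n !mul0r scaler0.
      by rewrite /GRing.scale /= expr2 !mulrA mulVf // mul1r.
    apply: cvg_within_filter.
    have : {for 0, continuous (fun h : R => h * `|h| ^+ q)}.
      apply: continuousM; first exact: cvg_id.
      apply: (@continuous_comp _ _ _ (fun h : R => `|h|) (fun t : R => t ^+ q)).
        exact: norm_continuous.
      exact: exprn_continuous.
    by rewrite /prop_for /continuous_at /= mul0r.
  by split; [apply/cvg_ex; exists 0 | exact: cvg_lim].
set r := Num.sqrt (a + b ^+ 2); have r0 : 0 < r by rewrite sqrtr_gt0.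
(* Away from the origin the chain rule applies; the last factor is [b / r], of absolute value at
   most 1. *)
exists (q.+2%:R * r ^+ q.+1 * ((2 * r)^-1 * (2 * b))).
  have d1 : is_derive (0 : R) 1 (fun h : R => a + (b + h) ^+ 2) (2 * b).
    have -> : (fun h : R => a + (b + h) ^+ 2) = cst a + (cst b + id) ^+ 2.
      by apply/funext => h; rewrite !fctE.
    apply: is_derive_eq; rewrite add0r add0r expr1 !fctE /=.
    by rewrite addr0 /GRing.scale /= mulr1.
  have d2 : is_derive (a + (b + 0) ^+ 2) 1 Num.sqrt (2 * r)^-1.
    by rewrite addr0; exact: is_derive1_sqrt.
  have d3 := @is_derive1_comp R Num.sqrt (fun h => a + (b + h) ^+ 2)
    0 _ _ d2 d1.
  have := is_deriveX q.+2 d3.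
  by rewrite exprfctE /= addr0.
have br : `|b| <= r by rewrite -sqrtr_sqr ler_wsqrtr // lerDr.
have c0 : 0 <= q.+2%:R * r ^+ q.+1 by rewrite mulr_ge0 // exprn_ge0 // ltW.
rewrite normrM (ger0_norm c0) ler_piMr //.
have -> : (2 * r)^-1 * (2 * b) = b / r by field; rewrite gt_eqF.
by rewrite normrM normfV (gtr0_norm r0) ler_pdivrMr // mul1r.
Qed.

Lemma enorm_shift_delta (R : realType) (n : nat) (v : 'rV[R]_n) (i : 'I_n)
    (h : R) :
  enorm (h *: delta_mx 0 i + v)
  = Num.sqrt (\sum_(j < n | j != i) v 0 j ^+ 2 + (v 0 i + h) ^+ 2).
Proof.
rewrite /enorm (bigD1 i) //= addrC; congr (Num.sqrt (_ + _)).
  by apply: eq_bigr => j /negbTE ji; rewrite !mxE ji andbF mulr0 add0r.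
by rewrite !mxE !eqxx mulr1 addrC.
Qed.

(** From [p >= 1] the exponent [p + 1] is at least 2, so the one-variable lemma applies to [z - x],
    also at [z = x]. *)
Lemma derive_enorm_pow (R : realType) (n p : nat) (x z : 'rV[R]_n)
    (i : 'I_n) : (1 <= p)%N ->
  derivable (fun z => enorm (z - x) ^+ p.+1) z (delta_mx 0 i) /\
  `|'D_(delta_mx 0 i) (fun z => enorm (z - x) ^+ p.+1) z|
    <= p.+1%:R * enorm (z - x) ^+ p.
Proof.
case: p => // q _; set e : 'rV[R]_n := delta_mx 0 i.
have a0 : 0 <= \sum_(j < n | j != i) (z - x) 0 j ^+ 2.
  by apply: sumr_ge0 => j _; rewrite sqr_ge0.
have [d dd dle] := is_derive_sqrt_sqr_pow ((z - x) 0 i) q a0.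
have zE : z = 0 *: e + z by rewrite scale0r add0r.
have lineE : (fun t : R => enorm (t *: e + z - x) ^+ q.+2)
    = (fun h : R => Num.sqrt (\sum_(j < n | j != i) (z - x) 0 j ^+ 2
        + ((z - x) 0 i + h) ^+ 2) ^+ q.+2).
  by apply/funext => h; rewrite -addrA enorm_shift_delta.
move: dd; rewrite -lineE => dd.
split.
  by rewrite zE; apply/derivable_line; exact: ex_derive.
rewrite {1}zE -derive_line derive_val (le_trans dle) //.
have := enorm_shift_delta (z - x) i 0; rewrite scale0r add0r addr0 => ->.
exact: lexx.
Qed.

(** * Block substitution and gradients of the block functions *)

Lemma plug_in (R : realType) (n : nat) (I : {set 'I_n}) (x : 'rV[R]_n)
    (z : 'rV[R]_#|I|) (j : 'I_#|I|) : plug x z 0 (enum_val j) = z 0 j.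
Proof.
rewrite mxE; case: pickP => [k /eqP/enum_val_inj -> //|/(_ j)].
by rewrite eqxx.
Qed.

Lemma plug_notin (R : realType) (n : nat) (I : {set 'I_n}) (x : 'rV[R]_n)
    (z : 'rV[R]_#|I|) (i : 'I_n) : i \notin I -> plug x z 0 i = x 0 i.
Proof.
move=> iI; rewrite mxE; case: pickP => // k /eqP ki.
by move: iI; rewrite -ki enum_valP.
Qed.

Lemma enum_val_ex (n : nat) (I : {set 'I_n}) (i : 'I_n) : i \in I ->
  exists j : 'I_#|I|, i = enum_val j.
Proof. by move=> iI; exists (enum_rank_in iI i); rewrite enum_rankK_in. Qed.

Lemma plug_subvec (R : realType) (n : nat) (I : {set 'I_n}) (x : 'rV[R]_n) :
  plug x (subvec I x) = x.
Proof.
apply/rowP => i; have [/enum_val_ex[j ->]|iI] := boolP (i \in I).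
  by rewrite plug_in mxE.
exact: plug_notin.
Qed.

Lemma plug_box (R : realType) (n : nat) (I : {set 'I_n}) (l u x : 'rV[R]_n)
    (z : 'rV[R]_#|I|) : box l u x -> box (subvec I l) (subvec I u) z ->
  box l u (plug x z).
Proof.
move=> bx bz i; have [/enum_val_ex[j ->]|iI] := boolP (i \in I).
  by rewrite plug_in; have := bz j; rewrite !mxE.
by rewrite plug_notin.
Qed.

Lemma plug_shift (R : realType) (n : nat) (I : {set 'I_n}) (x : 'rV[R]_n)
    (z : 'rV[R]_#|I|) (j : 'I_#|I|) (h : R) :
  plug x (h *: delta_mx 0 j + z)
  = h *: delta_mx 0 (enum_val j) + plug x z.
Proof.
apply/rowP => i; have [/enum_val_ex[k ->]|iI] := boolP (i \in I).
  by rewrite [RHS]mxE !plug_in !mxE (inj_eq enum_val_inj).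
have /negbTE ij : i != enum_val j.
  by apply: contraNneq iI => ->; exact: enum_valP.
by rewrite [RHS]mxE !plug_notin // !mxE ij andbF mulr0 add0r.
Qed.

(** [plug] sends the line along the [j]-th unit vector to the line along the [enum_val j]-th one, so
    both partial derivatives are that of the same one-variable function. *)
Lemma grad_plug (R : realType) (n : nat) (I : {set 'I_n}) (f : 'rV[R]_n -> R)
    (x : 'rV[R]_n) (z : 'rV[R]_#|I|) (j : 'I_#|I|) :
  grad (fun z => f (plug x z)) z 0 j = grad f (plug x z) 0 (enum_val j).
Proof.
have := derive_line f (plug x z) (delta_mx 0 (enum_val j)) 0.
have := derive_line (fun z => f (plug x z)) z (delta_mx 0 j) 0.
rewrite !scale0r !add0r !mxE => <- <-; congr (@derive R R R _ 0 1).
by apply/funext => t; rewrite plug_shift.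
Qed.

Lemma grad_reg_model (R : realType) (m p : nat) (M : 'rV[R]_m -> R)
    (xbar z : 'rV[R]_m) (sigma : R) (j : 'I_m) : (1 <= p)%N -> 0 <= sigma ->
  has_grad M z ->
  `|grad (reg_model p M xbar sigma) z 0 j - grad M z 0 j|
    <= sigma * (p.+1%:R * enorm (z - xbar) ^+ p).
Proof.
move=> p1 s0 dM; have [dN leN] := derive_enorm_pow xbar z j p1.
rewrite !mxE.
have -> : reg_model p M xbar sigma
    = M + sigma \*: (fun z => enorm (z - xbar) ^+ p.+1) by [].
rewrite deriveD //; last exact: derivableZ.
rewrite deriveZ // addrC addKr normrM ger0_norm //.
by rewrite ler_wpM2l.
Qed.

(** * Steps and regularization parameters of a run *)

(** The step length [d_k]; it is also the distance from [x^k] to [x^(k+1)], as coordinates outside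
    [I_k] stay fixed. *)
Definition cd_steplen (R : realType) (n : nat) (s : cd_data R n) (k : nat) : R :=
  enorm (cd_ztrial s k (cd_J s k) - cd_xbar s k).

Lemma cd_box (R : realType) (n : nat) (l u : 'rV[R]_n) (f : 'rV[R]_n -> R)
    (p : nat) (alpha sigmamin tau1 tau2 theta : R) (s : cd_data R n) :
  cd_run l u f p alpha sigmamin tau1 tau2 theta s ->
  forall k, box l u (cd_x s k).
Proof.
move=> run; elim=> [|k IH]; first exact: cd_start run.
have [_ ->] := cd_accept run k; apply: plug_box => //.
by have [] := cd_trial run (leqnn (cd_J s k)).
Qed.

Lemma cd_step_coord (R : realType) (n : nat) (l u : 'rV[R]_n)
    (f : 'rV[R]_n -> R) (p : nat) (alpha sigmamin tau1 tau2 theta : R)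
    (s : cd_data R n) :
  cd_run l u f p alpha sigmamin tau1 tau2 theta s ->
  forall k i, `|cd_x s k.+1 0 i - cd_x s k 0 i| <= cd_steplen s k.
Proof.
move=> run k i; have [_ ->] := cd_accept run k.
have [/enum_val_ex[j ->]|iI] := boolP (i \in cd_I s k).
  rewrite plug_in; apply: le_trans (coord_le_enorm _ j).
  by rewrite !mxE.
by rewrite plug_notin // subrr normr0 enorm_ge0.
Qed.

Lemma cd_decrease (R : realType) (n : nat) (l u : 'rV[R]_n)
    (f : 'rV[R]_n -> R) (p : nat) (alpha sigmamin tau1 tau2 theta : R)
    (s : cd_data R n) :
  cd_run l u f p alpha sigmamin tau1 tau2 theta s ->
  forall k, f (cd_x s k.+1) <= f (cd_x s k) - alpha * cd_steplen s k ^+ p.+1.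
Proof.
move=> run k; have [dec ->] := cd_accept run k.
by move: dec; rewrite /suff_decrease /cd_f /cd_xbar plug_subvec.
Qed.

(** Write [t = |z - xbar|^(p+1)]. If [sigma >= L + alpha], then [f_k(z) <= M_k(z) + L t <= M_k(xbar)
    - (sigma - L) t <= f_k(xbar) - alpha t], so [z] is accepted. A rejected [sigma] is thus below
    [L + alpha], and its update multiplies it by at most [tau2] or resets it to [sigmamin]. *)
Lemma cd_sigma_bounded (R : realType) (n : nat) (l u : 'rV[R]_n)
    (f : 'rV[R]_n -> R) (p : nat) (alpha sigmamin tau1 tau2 theta : R)
    (s : cd_data R n) : 0 < alpha -> 0 < sigmamin -> 1 < tau1 ->
  cd_run l u f p alpha sigmamin tau1 tau2 theta s ->
  model_accuracy f p s ->
  exists S : R, forall k j, (j <= cd_J s k)%N -> 0 <= cd_sigma s k j <= S.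
Proof.
move=> alpha0 smin0 tau1_gt1 run [L L0 acc].
exists (Num.max sigmamin (tau2 * (L + alpha))) => k [|j] jJ.
  by rewrite (cd_sigma0 run) lexx le_max ltW.
have jJ' := ltnW jJ.
have [nd [tau /andP[tau1_le tau_le] ->]] := cd_reject run jJ.
rewrite le_max (ltW smin0) /= ge_max le_max lexx /= le_max; apply/orP; right.
have [_ dec _] := cd_trial run jJ'.
have /= [_ MF FM] := acc k j jJ'.
have sigma_lt : cd_sigma s k j < L + alpha.
  rewrite ltNge; apply/negP => sge; apply: nd.
  move: dec FM sge; rewrite /reg_model /suff_decrease MF.
  have := exprn_ge0 p.+1 (enorm_ge0 (cd_ztrial s k j - cd_xbar s k)).
  set t := enorm _ ^+ _; set F := cd_f f s k _; set M := cd_M s k _.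
  set G := cd_f f s k _; set sg := cd_sigma s k j => t0 h1 h2 h3.
  have : (L + alpha) * t <= sg * t by rewrite ler_wpM2r.
  lra.
apply: (@le_trans _ _ (tau * (L + alpha))).
  by rewrite ler_wpM2l ?ltW //; lra.
by rewrite ler_wpM2r //; lra.
Qed.

(** At the accepted point, replacing the gradient of [f_k] by that of the regularized model costs
    [L d_k^p] for the model error and [S (p+1) d_k^p] for the regularization term; the stationarity
    test adds [theta d_k^p]. *)
Lemma cd_gproj_block_bound (R : realType) (n : nat) (l u : 'rV[R]_n)
    (f : 'rV[R]_n -> R) (p : nat) (alpha sigmamin tau1 tau2 theta : R)
    (s : cd_data R n) : (forall i, l 0 i <= u 0 i) -> (1 <= p)%N ->
  0 < alpha -> 0 < sigmamin -> 1 < tau1 ->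
  cd_run l u f p alpha sigmamin tau1 tau2 theta s ->
  model_accuracy f p s ->
  exists2 C : R, 0 < C & forall k i, i \in cd_I s k ->
    `|gproj l u f (cd_x s k.+1) 0 i| <= C * cd_steplen s k ^+ p.
Proof.
move=> lu p1 alpha0 smin0 tau1_gt1 run hypA.
have [S sgS] := cd_sigma_bounded alpha0 smin0 tau1_gt1 run hypA.
have [L L0 acc] := hypA.
have SS0 : 0 <= S.
  by have /andP[s0 sS] := sgS 0%N 0%N (leq0n _); exact: le_trans sS.
have c0 : 0 <= `|theta| + L + S * p.+1%:R.
  have := normr_ge0 theta; have : 0 <= S * p.+1%:R by rewrite mulr_ge0.
  lra.
(* The sign of [theta] is not assumed here, hence the absolute value; the 1 makes positivity
   immediate. *)
exists (1 + (`|theta| + L + S * p.+1%:R)); first by lra.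
move=> k i /enum_val_ex[j ->]; have [_ ->] := cd_accept run k.
rewrite gprojE // plug_in.
have /= [acc1 _ _] := acc k _ (leqnn (cd_J s k)).
have /andP[sg0 sgle] := sgS k _ (leqnn (cd_J s k)).
have [bz _ stat] := cd_trial run (leqnn (cd_J s k)).
have reg := grad_reg_model (cd_xbar s k) j p1 sg0 (cd_model run bz).
have lu' m : subvec (cd_I s k) l 0 m <= subvec (cd_I s k) u 0 m.
  by rewrite !mxE.
have subE (A B : 'rV[R]_#|cd_I s k|) : (A - B) 0 j = A 0 j - B 0 j.
  by rewrite !mxE.
have := le_trans (coord_le_enorm _ j) stat.
have := le_trans (coord_le_enorm _ j) acc1.
have clampE y : (\row_m clamp (subvec (cd_I s k) l 0 m)
    (subvec (cd_I s k) u 0 m) (y 0 m)) 0 j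
  = clamp (l 0 (enum_val j)) (u 0 (enum_val j)) (y 0 j) by rewrite !mxE.
rewrite eproj_box // !subE clampE subE /cd_f grad_plug.
move: reg; rewrite -/(cd_steplen s k).
set z := cd_ztrial s k _; set a := l 0 _; set b := u 0 _.
set gR := grad (reg_model _ _ _ _) z 0 j; set gM := grad (cd_M s k) z 0 j.
set gf := grad f _ 0 _; set t := cd_steplen s k ^+ p => h1 h2 h3.
have t0 : 0 <= t by rewrite exprn_ge0 // enorm_ge0.
have := clamp_lip a b (z 0 j - gf) (z 0 j - gR).
(* The model gradient [gM] is inserted between [gf] and [gR]. *)
have ->: z 0 j - gf - (z 0 j - gR) = (gR - gM) - (gf - gM) by ring.
have h4 := ler_normB (gR - gM) (gf - gM).
have h5 := ler_normD (clamp a b (z 0 j - gf) - clamp a b (z 0 j - gR))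
  (clamp a b (z 0 j - gR) - z 0 j).
rewrite addrA subrK in h5 => h6.
have h7 : S * (p.+1%:R * t) >= cd_sigma s k (cd_J s k) * (p.+1%:R * t).
  by rewrite ler_wpM2r // mulr_ge0.
have h8 : theta * t <= `|theta| * t by rewrite ler_wpM2r // ler_norm.
by lra.
Qed.

(** The values [f(x^k)] decrease and are bounded below, so they converge; their consecutive
    differences tend to 0 and dominate [alpha * d_k^(p+1)]. *)
Lemma cd_steplen_cvg0 (R : realType) (n : nat) (l u : 'rV[R]_n)
    (f : 'rV[R]_n -> R) (p : nat) (alpha sigmamin tau1 tau2 theta : R)
    (s : cd_data R n) : C1_on (box l u) f -> 0 < alpha ->
  cd_run l u f p alpha sigmamin tau1 tau2 theta s ->
  forall e : R, 0 < e -> \forall k \near \oo, cd_steplen s k < e.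
Proof.
move=> fC1 alpha0 run e e0; have [c fc] := C1_on_box_lbound fC1.
have d0 k : 0 <= cd_steplen s k ^+ p.+1 by rewrite exprn_ge0 // enorm_ge0.
pose F k := f (cd_x s k).
have Fdec : nonincreasing_seq F.
  apply/nonincreasing_seqP => k; apply: le_trans (cd_decrease run k) _.
  by rewrite gerBl mulr_ge0 // ltW.
have Fcvg : cvgn F.
  apply: nonincreasing_is_cvgn => //.
  by exists c => _ [k _ <-]; apply: fc; exact: cd_box run k.
have ep0 : 0 < alpha * e ^+ p.+1 by rewrite mulr_gt0 // exprn_gt0.
have : F k - F k.+1 @[k --> \oo] --> 0.
  rewrite -(subrr (limn F)); apply: cvgB => //.
  by have /cvg_comp := Fcvg; rewrite (@cvg_shiftS _ F).
move=> /cvgr0Pnorm_lt/(_ _ ep0); apply: filterS => k.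
move=> /(le_lt_trans (ler_norm _)) Fk.
have := cd_decrease run k; rewrite -/(F k) -/(F k.+1) => dec.
have : alpha * cd_steplen s k ^+ p.+1 < alpha * e ^+ p.+1 by lra.
by rewrite ltr_pM2l // ltr_pXn2r ?nnegrE ?enorm_ge0 ?ltW.
Qed.

Lemma cd_drift (R : realType) (n : nat) (l u : 'rV[R]_n)
    (f : 'rV[R]_n -> R) (p : nat) (alpha sigmamin tau1 tau2 theta : R)
    (s : cd_data R n) (k : nat) (e : R) :
  cd_run l u f p alpha sigmamin tau1 tau2 theta s ->
  (forall k', (k <= k')%N -> cd_steplen s k' <= e) ->
  forall m i, `|cd_x s (k + m) 0 i - cd_x s k 0 i| <= m%:R * e.
Proof.
move=> run small; elim=> [|m IH] i; first by rewrite addn0 subrr normr0 mul0r.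
rewrite addnS.
have h1 := le_trans (cd_step_coord run (k + m) i) (small _ (leq_addr _ _)).
have := ler_normD (cd_x s (k + m).+1 0 i - cd_x s (k + m) 0 i)
  (cd_x s (k + m) 0 i - cd_x s k 0 i).
by rewrite addrA subrK => h2; rewrite -natr1; have := IH i; lra.
Qed.

(** * Cyclic choice of indices and convergence *)

(** Induction on [k]: a visit [k'] is kept until [k = k' + mbar], then replaced by the next visit
    [k' + m], which is at most [k]; since [m >= 1], its window reaches [k + 1]. *)
Lemma recent_visit (n : nat) (I : nat -> {set 'I_n}) (i : 'I_n) (mbar : nat) :
  (exists2 k, (k <= mbar)%N & i \in I k) ->
  (forall k, i \in I k -> exists2 m, (1 <= m <= mbar)%N & i \in I (k + m)%N) ->
  forall k, (mbar <= k)%N ->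
    exists2 k', (k' <= k <= k' + mbar)%N & i \in I k'.
Proof.
move=> [k0 k0m ik0] next; elim=> [|k IH] mk.
  by exists k0 => //; rewrite (leq_trans k0m mk) (leq_trans _ (leq_addr _ _)).
move: mk; rewrite leq_eqVlt => /orP[/eqP mk|/IH[k' /andP[k'k kk'] ik']].
  by exists k0 => //; rewrite -mk k0m leq_addl.
have [kk''|] := leqP k.+1 (k' + mbar).
  by exists k' => //; rewrite kk'' leqW.
move=> k'm; have [m /andP[m1 mm] im] := next _ ik'.
by exists (k' + m)%N => //; apply/andP; split; lia.
Qed.

Lemma cd_gproj_coord_cvg0 (R : realType) (n : nat) (l u : 'rV[R]_n)
    (f : 'rV[R]_n -> R) (p : nat) (alpha sigmamin tau1 tau2 theta : R)
    (s : cd_data R n) : (forall i, l 0 i <= u 0 i) -> C1_on (box l u) f ->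
  (1 <= p)%N -> 0 < alpha -> 0 < sigmamin -> 1 < tau1 ->
  cd_run l u f p alpha sigmamin tau1 tau2 theta s ->
  model_accuracy f p s -> essentially_cyclic s ->
  forall e : R, 0 < e ->
    \forall k \near \oo, forall i, `|gproj l u f (cd_x s k) 0 i| < e.
Proof.
move=> lu fC1 p1 alpha0 smin0 tau1_gt1 run hypA [mbar cyc] e e0.
have [C C0 blk] := cd_gproj_block_bound lu p1 alpha0 smin0 tau1_gt1 run hypA.
have e20 : 0 < e / 2 by lra.
have [d d0 unif] := gproj_unif_continuous lu fC1.2 e20.
(* The bound 1 gives [d_k^p <= d_k]; [e / 2 / C] brings the block bound below [e / 2];
   [d / (mbar + 1)] keeps the drift over [mbar] steps below [d]. *)
pose h := Num.min 1 (Num.min (e / 2 / C) (d / mbar.+1%:R)).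
have h0 : 0 < h by rewrite !lt_min ltr01 !divr_gt0.
have h_le1 : h <= 1 by rewrite ge_min lexx.
have h_leC : h <= e / 2 / C by rewrite !ge_min lexx !orbT.
have h_led : h <= d / mbar.+1%:R by rewrite !ge_min lexx !orbT.
have [N _ small] := cd_steplen_cvg0 fC1 alpha0 run h0.
(* A visit at [k'] controls the iterate [k' + 1], hence the shift by one; the summand [mbar] ensures
   [k' >= N]. *)
exists (N + mbar).+1 => //= -[//|k] /= Nk i.
have [cyc0 cycS] := cyc i.
have [k' /andP[k'k kk'] ik'] := recent_visit cyc0 cycS
  (leq_trans (leq_addl N mbar) Nk).
have Nk' : (N <= k')%N by lia.
have g_small : `|gproj l u f (cd_x s k'.+1) 0 i| < e / 2.
  apply: le_lt_trans (blk _ _ ik') _; have := small k' Nk'.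
  have := enorm_ge0 (cd_ztrial s k' (cd_J s k') - cd_xbar s k').
  rewrite -/(cd_steplen s k') => t0 /= th.
  rewrite mulrC -ltr_pdivlMr //; apply: lt_le_trans h_leC.
  apply: (le_lt_trans _ th); case: p p1 {run hypA blk} => // q _.
  rewrite exprS ler_piMr // exprn_ile1 // ltW //.
  exact: lt_le_trans th h_le1.
have near_x j : `|cd_x s k.+1 0 j - cd_x s k'.+1 0 j| < d.
  have smallW m : (k'.+1 <= m)%N -> cd_steplen s m <= h.
    by move=> k'm; apply/ltW/small => /=; lia.
  have := cd_drift run smallW (k - k') j.
  rewrite addSn subnKC // => /le_lt_trans; apply.
  have : (k - k')%:R * h <= mbar%:R * h :> R.
    by rewrite ler_wpM2r ?(ltW h0) // ler_nat; lia.
  have := h_led; rewrite ler_pdivlMr // -natr1; nra.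
have := unif _ _ (cd_box run k.+1) (cd_box run k'.+1) near_x i.
have := ler_normD
  (gproj l u f (cd_x s k.+1) 0 i - gproj l u f (cd_x s k'.+1) 0 i)
  (gproj l u f (cd_x s k'.+1) 0 i).
rewrite subrK; lra.
Qed.

Theorem theorem4p3 (R : realType) (n : nat) (l u : 'rV[R]_n)
    (f : 'rV[R]_n -> R) (p : nat) (alpha sigmamin tau1 tau2 theta : R)
    (s : cd_data R n)
    (lu : forall i, l 0 i < u 0 i)
    (fC1 : C1_on (box l u) f)
    (p_ge1 : (1 <= p)%N)
    (alpha_gt0 : 0 < alpha)
    (sigmamin_gt0 : 0 < sigmamin)
    (tau1_gt1 : 1 < tau1)
    (tau12 : tau1 <= tau2)
    (theta_gt0 : 0 < theta)
    (run : cd_run l u f p alpha sigmamin tau1 tau2 theta s)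
    (hypA : model_accuracy f p s)
    (hypB : essentially_cyclic s) :
  enorm (gproj l u f (cd_x s k)) @[k --> \oo] --> (0 : R) /\
  forall xstar : 'rV[R]_n, box l u xstar ->
    seq_limit_point (cd_x s) xstar -> enorm (gproj l u f xstar) = 0.
Proof.
have luW i : l 0 i <= u 0 i by rewrite ltW.
have gcvg := cd_gproj_coord_cvg0 luW fC1 p_ge1 alpha_gt0 sigmamin_gt0
  tau1_gt1 run hypA hypB.
split.
  apply/cvgr0Pnorm_lt => e e0.
  (* The sum of [n] coordinates below [e / (n + 1)] stays below [e]; the denominator is nonzero even
     for [n = 0]. *)
  have en0 : 0 < e / n.+1%:R by rewrite divr_gt0.
  apply: filterS (gcvg _ en0) => k gk.
  rewrite ger0_norm ?enorm_ge0 //; apply: le_lt_trans (enorm_le_sum _) _.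
  apply: (@le_lt_trans _ _ (\sum_(i < n) e / n.+1%:R)).
    by apply: ler_sum => i _; exact: ltW.
  rewrite sumr_const card_ord -[ltLHS]mulr_natr mulrAC ltr_pdivrMr //.
  by rewrite ltr_pM2l // ltr_nat.
move=> xs bxs [phi phi_mono xphi].
have phi_ge k : (k <= phi k)%N.
  by elim: k => // k IH; apply: leq_ltn_trans IH (phi_mono _ _ (ltnSn k)).
have g0 i : gproj l u f xs 0 i = 0.
  (* The component is shown to be below every [e > 0]: far along the subsequence, [e / 2] bounds the
     component at the iterate and, by uniform continuity, its distance to the one at [xs]. *)
  apply/eqP; rewrite -normr_le0; apply/ler_addgt0Pl => e e0; rewrite addr0.
  have e20 : 0 < e / 2 by lra.
  have [d d0 unif] := gproj_unif_continuous luW fC1.2 e20.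
  have [N _ gN] := gcvg _ e20.
  have [M _ xM] := xphi _ (nbhsx_ballx xs d d0).
  pose k := maxn N M.
  have [_ near_x] := xM k (leq_maxr N M).
  have gk := gN (phi k) (leq_trans (leq_maxl N M) (phi_ge k)) i.
  have := unif xs (cd_x s (phi k)) bxs (cd_box run _) (near_x 0) i.
  have := ler_normD (gproj l u f xs 0 i - gproj l u f (cd_x s (phi k)) 0 i)
    (gproj l u f (cd_x s (phi k)) 0 i).
  rewrite subrK; lra.
by rewrite /enorm big1 ?sqrtr0 // => i _; rewrite g0 expr0n.
Qed.
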